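(* Let $G$ be a finite group with a subgroup $G^+$ of index $2$, and let $K_1,\ldots,K_k$ be distinct conjugacy classes of $G$, each consisting of involutions contained in $G\setminus G^+$, for some $k\ge 1$. Then there is a vertex-transitive map $\mathcal M$, on a compact orientable surface without boundary, such that ${\rm Aut}\,\mathcal M\cong G$, and such that under this isomorphism the reflections of $\mathcal M$ correspond to the elements of $K_1\cup\cdots\cup K_k$.
   Context: All maps (graphs embedded in surfaces; loops and multiple edges allowed) are connected. They are described algebraically as follows. Let $\Gamma=\langle R_0,R_1,R_2\mid R_0^2=R_1^2=R_2^2=(R_0R_2)^2=1\rangle$. A map $\mathcal M$ corresponds to a transitive (right) action of $\Gamma$ on a non-empty set $\Phi$, the set of flags (mutually incident vertex-edge-face triples) of $\mathcal M$, where $R_i$ sends each flag $\phi$ to the other flag sharing the same $j$-dimensional components for all $j\neq i$ if there is one, and fixes $\phi$ otherwise; every transitive $\Gamma$-set arises in this way. The vertices, edges and faces of $\mathcal M$ are the orbits on $\Phi$ of $\langle R_1,R_2\rangle$, $\langle R_0,R_2\rangle$ and $\langle R_0,R_1\rangle$ respectively, with incidence given by non-empty intersection. The map subgroups of $\mathcal M$ are the stabilisers $M\le\Gamma$ of flags (a conjugacy class of subgroups). The underlying surface is compact if and only if $\Phi$ is finite; it is orientable and without boundary if and only if $M\le\Gamma^+$, the index-$2$ subgroup of $\Gamma$ consisting of the words of even length in $R_0,R_1,R_2$. The automorphism group ${\rm Aut}\,\mathcal M$ is the group of permutations of $\Phi$ commuting with the action of $\Gamma$ (it is isomorphic to $N_\Gamma(M)/M$).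 The map $\mathcal M$ is vertex-transitive if ${\rm Aut}\,\mathcal M$ acts transitively on its vertices. A reflection of $\mathcal M$ is an automorphism (necessarily of order $2$) which fixes a point of the surface and acts as a reflection on a disc-shaped neighbourhood of that point; algebraically, it is an automorphism $r\ne 1$ such that $r(\phi)=\phi R_i$ for some flag $\phi\in\Phi$ and some $i\in\{0,1,2\}$ (equivalently, a non-identity automorphism induced by a conjugate of some $R_i$ lying in $N_\Gamma(M)$). *)

(* Defs.v *)
From mathcomp Require Import all_boot all_fingroup.

Set Implicit Arguments.
Unset Strict Implicit.
Unset Printing Implicit Defensive.

Import GroupScope.

(* A map is a transitive action of
     Gamma = < R0, R1, R2 | R0^2 = R1^2 = R2^2 = (R0 R2)^2 = 1 >
   on a non-empty set of flags; by the universal property of the presentation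
   this is a triple of permutations satisfying the relations.  The underlying
   surface is compact iff the set of flags is finite, hence the finType.
   Gamma acts on the right, which agrees with the product of {perm Phi}, where
   (s * t) x = t (s x).  Some of the three permutations may have fixed points
   or coincide. *)
Record compact_map (Phi : finType) := CompactMap {
  R0 : {perm Phi};
  R1 : {perm Phi};
  R2 : {perm Phi};
  R0_sq : R0 ^+ 2 = 1;
  R1_sq : R1 ^+ 2 = 1;
  R2_sq : R2 ^+ 2 = 1;
  R0R2_sq : (R0 * R2) ^+ 2 = 1;
  (* this also forces Phi to be non-empty *)
  R_trans : [transitive <<[set R0; R1; R2]>>, on [set: Phi] | 'P]
}.

Section Maps.

Variables (Phi : finType) (M : compact_map Phi).

Definition monodromy : {group {perm Phi}} := <<[set R0 M; R1 M; R2 M]>>%G.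

Definition gen (i : 'I_3) : {perm Phi} := tnth [tuple R0 M; R1 M; R2 M] i.

Definition word_perm (w : seq 'I_3) : {perm Phi} := \prod_(i <- w) gen i.

(* The flag stabilisers lie in Gamma^+.  The relators have even length, so an
   element of Gamma lies in Gamma^+ iff any word representing it is even. *)
Definition orientable_without_boundary : Prop :=
  forall (phi : Phi) (w : seq 'I_3), word_perm w phi = phi -> ~~ odd (size w).

Definition vertices : {set {set Phi}} :=
  [set orbit 'P <<[set R1 M; R2 M]>> phi | phi : Phi].

(* The permutations of Phi commuting with the action of Gamma. *)
Definition map_aut : {group {perm Phi}} := 'C(monodromy)%G.

Definition vertex_transitive : bool :=
  [transitive map_aut, on vertices | ('P^*)%act].

Definition reflections : {set {perm Phi}} :=
  [set r in map_aut | (r != 1) && [exists phi, exists i, r phi == gen i phi]].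

End Maps.

(* Main.v *)
Require Import Defs.
From mathcomp Require Import all_boot all_fingroup.

Set Implicit Arguments.
Unset Strict Implicit.
Unset Printing Implicit Defensive.

Import GroupScope.

(** The map is a Cayley map: its vertices are the elements of G, on which G
    acts regularly by left multiplication, and all vertices carry the same
    cyclically ordered set D of darts.  A dart d has a label lab d in G; at
    the vertex g it leads to g * lab d, where it arrives as the dart tau d,
    with tau an involution and lab (tau d) = (lab d)^-1.  A flag is a triple
    (g, d, e), with e telling on which side of the dart the flag lies.

    Orientability comes from letting the elements outside Gplus reverse the
    orientation: the cyclic order is read one way at the vertices in Gplus
    and the other way at the others, so that the parity of (g outside Gplus)
    plus e changes under each of R0, R1, R2.

    Left multiplication by h never changes the components d and e.  Since R1
    and R2 change e, it can agree with some R_i on a flag (g, d, e) only if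
    i = 0 and tau d = d, and then h is the conjugate of lab d by g^-1.  So
    the reflections contained in G are the conjugates of the labels of the
    darts fixed by tau, and one such dart is taken for each K_i, labelled by
    a member of K_i.  All other darts come in pairs exchanged by tau; each
    element of G other than 1 labels such a pair, which makes the map
    connected.

    There remains to exclude automorphisms outside G.  Composing with an
    element of G, one may assume that the vertex 1 is fixed; the automorphism
    then acts on D as a rotation or a reflection of the cyclic order.  It
    preserves the set of loops, which are the darts of label 1.  Two pairs of
    loops are inserted, at the places 0, 1, 2, 4 of the cyclic order, with no
    loop at the places -2, -1, 3, 5: no rotation but the identity, and no
    reflection, preserves this pattern (rigid_turns, rigid_reflected_turns).
    An automorphism fixing a flag is the identity, so Aut M = G
    (rigid_aut). *)

(** * Cayley maps *)

Section CayleyMap.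

Variables (H : finGroupType) (D : finType).
(* rho is the cyclic order of the darts around a vertex; chi tells which
   elements of H reverse the orientation. *)
Variables (lab : D -> H) (tau : D -> D) (rho : {perm D}) (chi : H -> bool).

Hypothesis tauK : involutive tau.
Hypothesis lab_tau : forall d, lab (tau d) = (lab d)^-1.
Hypothesis chiM : {morph chi : g h / g * h >-> g (+) h}.
Hypothesis rho_trans : forall d d', exists n, (rho ^+ n) d = d'.
Hypothesis lab_surj : forall h, exists d, lab d = h.
(* A translation reverses the edge of a dart fixed by tau; it is a reflection
   of this edge, and not a half-turn, when the label reverses the
   orientation. *)
Hypothesis lab_fix : forall d, tau d = d -> chi (lab d).

Let flag := (H * D * bool)%type.

(** The sign chi (lab d) is what makes R0 reverse the orientation: it keeps the
    side e when the two ends of the edge are oriented in opposite ways. *)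
Definition along (p : flag) : flag :=
  let: (g, d, e) := p in (g * lab d, tau d, e (+) ~~ chi (lab d)).
Definition around (p : flag) : flag :=
  let: (g, d, e) := p in
  (g, if e then rho d else rho^-1 d, ~~ e).
Definition across (p : flag) : flag :=
  let: (g, d, e) := p in (g, d, ~~ e).

Lemma chi1 : chi 1 = false.
Proof. by have:= chiM 1 1; rewrite mulg1; case: (chi 1). Qed.

Lemma chiV h : chi h^-1 = chi h.
Proof.
by have := chiM h h^-1; rewrite mulgV chi1; do 2!case: (chi _).
Qed.

Lemma alongK : involutive along.
Proof.
by case=> -[g d] e; rewrite /= lab_tau mulgK tauK chiV -addbA addbb addbF.
Qed.
Lemma aroundK : involutive around.
Proof. by case=> -[g d] [] /=; rewrite ?permK ?permKV. Qed.
Lemma acrossK : involutive across.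
Proof. by case=> -[g d] e; rewrite /= negbK. Qed.

Definition alongp : {perm flag} := perm (inv_inj alongK).
Definition aroundp : {perm flag} := perm (inv_inj aroundK).
Definition acrossp : {perm flag} := perm (inv_inj acrossK).

Lemma alongpE p : alongp p = along p. Proof. exact: permE. Qed.
Lemma aroundpE p : aroundp p = around p. Proof. exact: permE. Qed.
Lemma acrosspE p : acrossp p = across p. Proof. exact: permE. Qed.

Lemma perm_involutive_sq (T : finType) (f : T -> T) (fI : injective f) :
  involutive f -> (perm fI) ^+ 2 = 1.
Proof. by move=> fK; apply/permP=> x; rewrite expgS expg1 permM !permE fK. Qed.

Lemma along_across_sq : (alongp * acrossp) ^+ 2 = 1.
Proof.
apply/permP=> -[[g d] e].
rewrite expgS expg1 !permM perm1 !(alongpE, acrosspE) /=.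
by rewrite lab_tau mulgK tauK chiV; case: e; case: (chi _).
Qed.

(** R1 R2 turns the flags at a vertex by one dart, in opposite directions on
    the two sides of the darts. *)
Lemma rotationE n g d e :
  ((aroundp * acrossp) ^+ n) (g, d, e) =
  (g, if e then (rho ^+ n) d else (rho ^- n) d, e).
Proof.
elim: n g d e => [|n IHn] g d e; first by rewrite !expg0 invg1 !perm1; case: e.
rewrite expgS !permM aroundpE acrosspE /= negbK IHn.
by case: e; [rewrite expgS permM | rewrite expgSr invMg permM].
Qed.

Lemma rotationP g d d' e :
  exists n, ((aroundp * acrossp) ^+ n) (g, d, e) = (g, d', e).
Proof.
case: e.
  by have [n Dd'] := rho_trans d d'; exists n; rewrite rotationE Dd'.
by have [n Dd] := rho_trans d' d; exists n; rewrite rotationE -Dd permK.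
Qed.

Lemma vertex_orbit p :
  orbit 'P <<[set aroundp; acrossp]>> p = [set q : flag | q.1.1 == p.1.1].
Proof.
apply/setP=> q; rewrite inE; apply/orbitP/eqP => [[a] | Epq].
  case/gen_prodgP=> n [c Hc ->] <-.
  elim/big_rec: _ p => [|i c' _ IHc] p; rewrite /= !apermE ?perm1 // permM.
  have:= IHc (c i p); rewrite /= apermE => ->.
  case/set2P: (Hc i) => ->; rewrite ?(aroundpE, acrosspE);
    by case: p => -[g d] e.
case: p q Epq => [[g d] e] [[g' d'] e'] /= ->{g'}.
have [n Rn] := rotationP g d d' e.
have Ga : aroundp \in <<[set aroundp; acrossp]>> by rewrite mem_gen ?set21.
have Gc : acrossp \in <<[set aroundp; acrossp]>> by rewrite mem_gen ?set22.
case: (eqVneq e e') => [<-|neq_ee'].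
  by exists ((aroundp * acrossp) ^+ n); rewrite ?groupX ?groupM // apermE.
exists ((aroundp * acrossp) ^+ n * acrossp); first by rewrite !(groupX, groupM).
by rewrite apermE permM Rn acrosspE /=; case: e e' neq_ee' {Rn} => [] [].
Qed.

Lemma cayley_trans :
  [transitive <<[set alongp; aroundp; acrossp]>>, on [set: flag] | 'P].
Proof.
set A := <<_>>.
have sA : <<[set aroundp; acrossp]>> \subset A.
  by apply/genS/subsetP=> c; rewrite !inE -orbA => ->; rewrite orbT.
have [d1 d1P] := lab_surj 1; pose p0 : flag := (1, d1, true).
suff orbA p : p \in orbit 'P A p0.
  apply/imsetP; exists p0 => //; apply/esym/eqP.
  by rewrite -subTset; apply/subsetP.
have vert q q' : q.1.1 = q'.1.1 -> q' \in orbit 'P A q.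
  move=> Eq; have: q' \in orbit 'P <<[set aroundp; acrossp]>> q.
    by rewrite vertex_orbit inE Eq.
  by case/orbitP=> a Ra <-; apply: mem_orbit; apply: subsetP Ra.
case: p => -[g d] e; have [dg dgP] := lab_surj g.
(* The edge from the vertex 1 along a dart of label g ends at the vertex g. *)
apply: (orbit_trans (vert (alongp (1, dg, true)) _ _)).
  by rewrite alongpE /= dgP mul1g.
have Aa : alongp \in A by rewrite mem_gen // !inE eqxx.
apply: (orbit_trans (mem_orbit _ _ Aa)).
exact: vert.
Qed.

Definition cayley_map : compact_map flag :=
  CompactMap (perm_involutive_sq _ alongK) (perm_involutive_sq _ aroundK)
    (perm_involutive_sq _ acrossK) along_across_sq cayley_trans.

Lemma cayley_orientable : orientable_without_boundary cayley_map.
Proof.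
(* The orientation class of a flag, changed by each generator. *)
pose side (p : flag) := chi p.1.1 (+) p.2.
have side_gen i p : side (gen cayley_map i p) = ~~ side p.
  case: i => [[|[|[|//]]] ?]; rewrite /gen /= /tnth /= permE;
    case: p => -[g d] e; rewrite /side /= ?addbN // ?chiM.
  by case: (chi g); case: (chi _); case: e.
have side_word w p : side (word_perm cayley_map w p) = odd (size w) (+) side p.
  elim: w p => [|i w IHw] p; rewrite /word_perm ?big_nil ?perm1 //.
  rewrite big_cons permM -[\prod_(j <- w) _]/(word_perm _ w) IHw side_gen.
  by rewrite /= addbN addNb.
move=> p w fix_p; have := side_word w p.
by rewrite fix_p; case: (odd _); case: (side p).
Qed.

(** The inverse is needed because the product of permutations applies the left
    factor first, while left multiplication applies the right one first. *)
Definition translate (h : H) (p : flag) : flag := (h^-1 * p.1.1, p.1.2, p.2).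
Lemma translate_inj h : injective (translate h).
Proof. by move=> [[g d] e] [[g' d'] e'] [/mulgI-> -> ->]. Qed.
Definition translation h : {perm flag} := perm (@translate_inj h).
Lemma translationE h p : translation h p = translate h p.
Proof. exact: permE. Qed.

Lemma translationM : {in [set: H] &, {morph translation : g h / g * h}}.
Proof.
move=> g h _ _; apply/permP=> p.
by rewrite permM !translationE /translate /= invMg mulgA.
Qed.
Canonical translation_morphism := Morphism translationM.

Lemma injm_translation : 'injm translation.
Proof.
apply/injmP=> g h _ _ /permP Egh; have [d _] := lab_surj 1.
have := Egh (1, d, true); rewrite !translationE => -[].
by rewrite !mulg1 => /invg_inj.
Qed.

Lemma map_autP (a : {perm flag}) : reflect
  [/\ forall p, a (along p) = along (a p), forall p, a (around p) = around (a p)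
     & forall p, a (across p) = across (a p)] (a \in map_aut cayley_map).
Proof.
have Ecomm f (fI : injective f) :
    (forall p, a (f p) = f (a p)) <-> a * perm fI = perm fI * a.
  split=> [E|/permP E p]; last by have := E p; rewrite !permM !permE.
  by apply/permP=> p; rewrite !permM !permE E.
rewrite /= cent_gen /=; apply: (iffP centP) => [ca | [c0 c1 c2] x].
  split; [apply/(Ecomm _ (inv_inj alongK))
        | apply/(Ecomm _ (inv_inj aroundK))
        | apply/(Ecomm _ (inv_inj acrossK))];
    by apply: ca; rewrite !inE eqxx ?orbT.
by rewrite !inE -orbA => /or3P[]/eqP->; apply/Ecomm.
Qed.

Lemma translation_aut h : translation h \in map_aut cayley_map.
Proof.
apply/map_autP; split=> -[[g d] e]; rewrite !translationE /translate //=.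
by rewrite mulgA.
Qed.

Lemma aut_rotation a n p : a \in map_aut cayley_map ->
  a (((aroundp * acrossp) ^+ n) p) = ((aroundp * acrossp) ^+ n) (a p).
Proof.
case/map_autP=> _ c1 c2; elim: n p => [|n IHn] p.
  by rewrite !expg0 !perm1.
by rewrite expgS 2!permM IHn !permM !(aroundpE, acrosspE) c2 c1.
Qed.

Lemma aut_vertex a p q : a \in map_aut cayley_map ->
  p.1.1 = q.1.1 -> (a p).1.1 = (a q).1.1.
Proof.
move=> aut_a; case: p q => -[g d] e [[_ d'] e'] /= <-.
have [_ _ c2] := map_autP _ aut_a.
have [n Rn] := rotationP g d d' e.
have rot_vertex q : (((aroundp * acrossp) ^+ n) q).1.1 = q.1.1.
  by case: q => -[g' d''] e''; rewrite rotationE.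
have <-: (a (g, d', e)).1.1 = (a (g, d, e)).1.1.
  by rewrite -Rn aut_rotation ?rot_vertex.
case: (eqVneq e e') => [-> // | neq_ee'].
have ->: (g, d', e') = across (g, d', e) by case: e e' neq_ee' {Rn} => [] [].
by rewrite c2; case: (a _) => -[].
Qed.

Lemma cayley_vertex_transitive : vertex_transitive cayley_map.
Proof.
have [d _] := lab_surj 1; pose v g := [set q : flag | q.1.1 == g].
have vE p : orbit 'P <<[set aroundp; acrossp]>> p = v p.1.1.
  exact: vertex_orbit.
have aut_v a g : a \in map_aut cayley_map ->
    a @: v g = v (a (g, d, true)).1.1.
  move=> aut_a; apply/setP=> q; rewrite inE; apply/imsetP/eqP=> [[p] | Eq].
    by rewrite inE => /eqP Eg ->; apply: aut_vertex.
  exists (a^-1 q); last by rewrite permKV.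
  by rewrite inE (aut_vertex (groupVr aut_a) Eq) permK.
have vertP V : reflect (exists g, V = v g) (V \in vertices cayley_map).
  apply: (iffP imsetP) => [[p _ ->] | [g ->]].
    by exists p.1.1; rewrite vE.
  by exists (g, d, true); rewrite ?vE.
apply/imsetP; exists (v 1); first by apply/vertP; exists 1.
apply/setP=> V; apply/vertP/orbitP => [[g ->] | [a aut_a <-]].
  exists (translation g^-1); rewrite ?translation_aut //= /setact.
  by rewrite aut_v ?translation_aut // translationE /= invgK mulg1.
by exists (a (1, d, true)).1.1; rewrite -aut_v.
Qed.

(** Automorphisms act semiregularly on the flags: the value at one flag
    determines the others, because the monodromy group is transitive. *)
Lemma aut_translation a p h : a \in map_aut cayley_map ->
  a p = translation h p -> a = translation h.
Proof.
move=> aut_a Ep; have aut_h := translation_aut h; apply/permP=> q.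
have [c Mc <-] : exists2 c, c \in monodromy cayley_map & c p = q.
  by have /orbitP[c] : q \in orbit 'P (monodromy cayley_map) p;
    [rewrite (atransP cayley_trans) ?inE | exists c].
by rewrite -!permM -(centP aut_a) // -(centP aut_h) // !permM Ep.
Qed.

(* The loops are the darts of label 1.  The next two hypotheses say that, seen
   from the base dart b, their places in the cyclic order have no symmetry. *)
Variable b : D.
Hypothesis rigid_rot : forall d,
  (forall n, (lab ((rho ^+ n) d) == 1) = (lab ((rho ^+ n) b) == 1)) -> d = b.
Hypothesis rigid_refl : forall d,
  ~ (forall n, (lab ((rho ^- n) d) == 1) = (lab ((rho ^+ n) b) == 1)).

(** An automorphism maps loops to loops, a loop being a dart whose edge stays
    at its vertex, and acts on the darts at a vertex by a symmetry of their
    cyclic order.  If the loops have no such symmetry, the base flag at the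
    vertex 1 can only go to the base flag at some vertex g, as under a
    translation. *)
Lemma rigid_aut : map_aut cayley_map = translation @* [set: H] :> {set _}.
Proof.
apply/eqP; rewrite eqEsubset; apply/andP; split; last first.
  by apply/subsetP=> _ /morphimP[h _ _ ->]; apply: translation_aut.
apply/subsetP=> a aut_a; case Ea: (a (1, b, true)) => [[g d] e].
(* The action of R0 recognises the loops. *)
have loopE p : (lab p.1.2 == 1) = ((along p).1.1 == p.1.1).
  by case: p => -[g' d'] e' /=; rewrite -{2}[g']mulg1 (inj_eq (mulgI g')).
have aut_loop p : (lab (a p).1.2 == 1) = (lab p.1.2 == 1).
  have [c0 _ _] := map_autP _ aut_a; rewrite !loopE -c0; apply/eqP/eqP=> E.
    have [c0' _ _] := map_autP _ (groupVr aut_a).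
    by have := aut_vertex (groupVr aut_a) E; rewrite !permK.
  exact: aut_vertex.
have pattern n :
  (lab (if e then (rho ^+ n) d else (rho ^- n) d) == 1)
    = (lab ((rho ^+ n) b) == 1).
  have := aut_loop (((aroundp * acrossp) ^+ n) (1, b, true)).
  by rewrite aut_rotation // Ea !rotationE.
case: e Ea pattern => [Ea pattern | _ /rigid_refl//].
rewrite (rigid_rot pattern) in Ea.
rewrite (@aut_translation a (1, b, true) g^-1) ?mem_morphim ?inE //.
by rewrite Ea translationE /translate /= invgK mulg1.
Qed.

(** A translation preserves the dart and the side of a flag, while R1 and R2
    change the side; so a reflection agrees with R0 on some flag (g, d, e),
    which forces tau d = d and makes it the translation by a conjugate of
    lab d. *)
Lemma rigid_reflections :
  reflections cayley_map =
    translation @*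
      [set h | [exists d, (tau d == d) && (h^-1 \in lab d ^: [set: H])]].
Proof.
apply/setP=> a; rewrite inE rigid_aut; apply/andP/morphimP.
  case=> /morphimP[h _ _ ->] /andP[_ /existsP[[[g d] e] /existsP[i Ei]]].
  exists h; rewrite ?inE //; apply/existsP; exists d; move: Ei.
  rewrite translationE; case: i => [[|[|[|//]]] ?]; rewrite /gen /= /tnth /=
     !(alongpE, aroundpE, acrosspE) => /eqP[].
  - move=> Eg Ed _; rewrite -Ed eqxx; apply/imsetP.
    exists g^-1; rewrite ?inE //.
    by rewrite /conjg invgK mulgA -Eg mulgK.
  - by case: e.
  - by case: e.
case=> h _ /[1!inE]/existsP[d /andP[/eqP fix_d /imsetP[g _ Eh]]] ->.
split; first by rewrite mem_morphim ?inE.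
apply/andP; split.
  apply/eqP=> h1; have {}h1: h = 1.
    by apply: (injmP injm_translation); rewrite ?inE // h1 morph1.
  have:= lab_fix fix_d; move/eqP: Eh.
  by rewrite h1 invg1 eq_sym conjg_eq1 => /eqP->; rewrite chi1.
apply/existsP; exists (g^-1, d, true); apply/existsP; exists ord0.
rewrite /gen tnth0 alongpE translationE /translate /= fix_d lab_fix // Eh.
by rewrite /conjg mulgA mulgK.
Qed.

End CayleyMap.

(** * A cyclically ordered set of darts without symmetry *)

Lemma invg_order2 (gT : finGroupType) (x : gT) : #[x] = 2%N -> x^-1 = x.
Proof.
move=> ox; apply/eqP.
by rewrite eq_invg_mul -[x * x]/(x ^+ 2) -ox expg_order.
Qed.

Section RigidDarts.

Variables (H : finGroupType) (k : nat) (r : 'I_k -> H).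
Hypothesis k_gt0 : (0 < k)%N.
Hypothesis r_invol : forall i, #[r i] = 2%N.

(** The summand bool * bool consists of two pairs of loops, {h | h != 1} * bool
    of a pair of darts for each h other than 1, and 'I_k of the darts that
    create the reflections. *)
Definition dart : finType := ((bool + {h : H | h != 1}) * bool + 'I_k)%type.

Definition label (d : dart) : H :=
  match d with
  | inl (inl _, _) => 1
  | inl (inr h, e) => if e then val h else (val h)^-1
  | inr i => r i
  end.

Definition reverse (d : dart) : dart :=
  match d with inl (x, e) => inl (x, ~~ e) | inr i => inr i end.

Lemma reverseK : involutive reverse.
Proof. by case=> [[x e]|i] //=; rewrite negbK. Qed.

Lemma invol_neq1 i : r i != 1.
Proof. by rewrite -order_eq1 r_invol. Qed.

Lemma label_reverse d : label (reverse d) = (label d)^-1.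
Proof.
case: d => [[[c|h] e]|i] /=; first by rewrite invg1.
  by case: e; rewrite ?invgK.
by rewrite invg_order2.
Qed.

Lemma label_surj h : exists d, label d = h.
Proof.
case: (eqVneq h 1) => [->|nt_h]; first by exists (inl (inl true, true)).
by exists (inl (inr (exist _ h nt_h), true)).
Qed.

Lemma label_eq1 d :
  (label d == 1) = if d is inl (inl _, _) then true else false.
Proof.
case: d => [[[c|[h nt_h]] e]|i] /=; first by rewrite eqxx.
  by case: e; rewrite ?invg_eq1 (negPf nt_h).
exact: negPf (invol_neq1 i).
Qed.

(* This prefix of the cyclic order starts with two darts that are not loops, so
   that no loop lies at the places -2 and -1 seen from the loop base, which is
   its third item; h0 can be any element other than 1. *)
Let i0 : 'I_k := Ordinal k_gt0.
Let h0 : {h : H | h != 1} := exist _ (r i0) (invol_neq1 i0).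
Let first_darts : seq dart :=
  [:: inl (inr h0, true); inl (inr h0, false);
      inl (inl true, true); inl (inl true, false); inl (inl false, true);
      inr i0; inl (inl false, false)].
Let other_darts := [seq d <- enum dart | d \notin first_darts].
Let darts := first_darts ++ other_darts.

Lemma darts_uniq : uniq darts.
Proof.
rewrite cat_uniq filter_uniq ?enum_uniq // andbT; apply/andP; split.
  by rewrite /= !inE /eq_op /= /eq_op /= /eq_op /= ?eqxx.
by apply/hasPn=> d; rewrite mem_filter => /andP[].
Qed.

Lemma mem_darts d : d \in darts.
Proof. by rewrite mem_cat mem_filter mem_enum andbT orbN. Qed.

Definition turn : {perm dart} := perm (can_inj (prev_next darts_uniq)).

Lemma turn_cycle : fcycle turn darts.
Proof.
rewrite (@eq_fcycle _ turn (next darts)) ?cycle_next ?darts_uniq // => d.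
exact: permE.
Qed.

Lemma turn_trans d d' : exists n, (turn ^+ n) d = d'.
Proof.
exists (findex turn d d'); rewrite permX iter_findex //.
by rewrite (fconnect_cycle turn_cycle) ?mem_darts.
Qed.

Let loop d := label d == 1.
Let base : dart := inl (inl true, true).

Lemma turn_first_darts :
  [/\ [/\ turn (inl (inr h0, true)) = inl (inr h0, false),
          turn (inl (inr h0, false)) = base,
          turn base = inl (inl true, false)
        & turn (inl (inl true, false)) = inl (inl false, true)],
      turn (inl (inl false, true)) = inr i0,
      turn (inr i0) = inl (inl false, false)
    & ~~ loop (turn (inl (inl false, false)))].
Proof.
have:= turn_cycle; rewrite /darts /= => /and5P[/eqP-> /eqP-> /eqP-> /eqP->].
case/and3P=> /eqP-> /eqP-> turn_last; split=> //.
have: all (predC loop) other_darts.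
  apply/allP=> d; rewrite mem_filter /= /loop label_eq1.
  by case: d => [[[[] | h] []] | i].
(* The last dart of the prefix is followed by one of the other darts or, if
   there are none, by the first dart of the prefix. *)
move: turn_last.
case: other_darts => [|d s] /= /andP[/eqP-> _] => [_|/andP[]//].
by rewrite /loop label_eq1.
Qed.

Lemma turnV_first_darts :
  [/\ turn^-1 (inl (inl false, true)) = inl (inl true, false),
      turn^-1 (inl (inl true, false)) = base,
      turn^-1 base = inl (inr h0, false)
    & turn^-1 (inl (inr h0, false)) = inl (inr h0, true)].
Proof. by have [[<- <- <- <-] _ _ _] := turn_first_darts; rewrite !permK. Qed.

(** The loops are at the places 0, 1, 2, 4 from base, and 3 and 5 are not loops.
    If d is at the place t, then t, t + 1 and t + 2 are places of loops, which
    excludes t = 1, 2 and 4. *)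
Lemma rigid_turns d :
  (forall n, loop ((turn ^+ n) d) = loop ((turn ^+ n) base)) -> d = base.
Proof.
have [[_ _ t2 t3] t4 t5 t6] := turn_first_darts.
move=> Ed; have:= Ed 0%N; have:= Ed 1%N; have:= Ed 2%N.
rewrite !permX /= t2 t3 /loop !label_eq1.
case: d {Ed} => [[[[] | h] []]|i] //=.
- by rewrite t3 t4.
- by rewrite t4 t5.
- by move: t6; rewrite /loop label_eq1 => /negPf->.
Qed.

(** Here t, t - 1, t - 2 and t - 4 would be places of loops; the place -1
    excludes t = 0 and t = 1, the place -2 excludes t = 2 and the place 3
    excludes t = 4. *)
Lemma rigid_reflected_turns d :
  ~ (forall n, loop ((turn ^- n) d) = loop ((turn ^+ n) base)).
Proof.
have [[_ _ t2 t3] t4 t5 t6] := turn_first_darts.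
have [v4 v3 v2 v1] := turnV_first_darts.
have v5 : turn^-1 (inl (inl false, false)) = inr i0 by rewrite -t5 permK.
move=> Ed; have:= Ed 0%N; have:= Ed 1%N; have:= Ed 2%N; have:= Ed 4%N.
rewrite -!expVgn !permX /= t2 t3 t4 t5 /loop !label_eq1.
case: d {Ed} => [[[[] | h] []]|i] //=.
- by rewrite v2.
- by rewrite v3 v2.
- by rewrite v4 v3 v2 v1.
- by rewrite v5.
Qed.

End RigidDarts.

(** * Realising a group with prescribed reflections *)

Theorem theorem1p1 (gT : finGroupType) (G Gplus : {group gT})
    (sGplusG : Gplus \subset G) (indexGplus : #|G : Gplus| = 2%N)
    (k : nat) (k_gt0 : (0 < k)%N) (K : 'I_k -> {set gT})
    (K_distinct : injective K)
    (K_class : forall i, K i \in classes G)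
    (K_invol : forall i x, x \in K i -> #[x] = 2%N)
    (K_notin : forall i, K i \subset G :\: Gplus) :
  exists (Phi : finType) (M : compact_map Phi),
    [/\ vertex_transitive M,
        orientable_without_boundary M
      & exists f : {morphism G >-> {perm Phi}},
          isom G (map_aut M) f
          /\ f @* (\bigcup_(i < k) K i) = reflections M].
Proof.
(* The Cayley map is built over the group type whose elements are those of G. *)
pose r i := subg G (repr (K i)).
have reprK i : repr (K i) \in K i.
  by case/imsetP: (K_class i) => x _ ->; apply: mem_repr (class_refl G x).
have sKG i : K i \subset G by apply: subset_trans (K_notin i) (subsetDl _ _).
have val_r i : sgval (r i) = repr (K i).
  by rewrite [LHS]subgK ?(subsetP (sKG i)).
have r_invol i : #[r i] = 2%N.
  by rewrite -(order_injm (injm_sgval G)) ?inE //= val_r (K_invol i).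
pose chi (h : subg_of G) := sgval h \notin Gplus.
have chiM : {morph chi : g h / g * h >-> g (+) h}.
  move=> g h; rewrite /chi /=; case: (boolP (sgval g \in Gplus)) => [Pg|P'g].
    by rewrite groupMl.
  case: (boolP (sgval h \in Gplus)) => [Ph|P'h].
    by rewrite groupMr // P'g.
  apply/negbTE; rewrite negbK -[sgval h]invgK -mem_rcoset.
  by rewrite (rcoset_index2 sGplusG) // !inE ?groupV ?P'g ?P'h subgP.
have chi_fix (d : dart (subg_of G) k) : reverse d = d -> chi (label r d).
  case: d => [[x []]|i] //= _; rewrite /chi val_r.
  by have /setDP[] := subsetP (K_notin i) _ (reprK i).
pose M := cayley_map (@reverseK _ k) (label_reverse r_invol) chiM
  (turn_trans k_gt0 r_invol) (@label_surj _ _ r).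
have rot_rigid := @rigid_turns _ _ _ k_gt0 r_invol.
have refl_rigid := @rigid_reflected_turns _ _ _ k_gt0 r_invol.
exists _, M; split.
- exact: cayley_vertex_transitive.
- exact: cayley_orientable.
pose f x := translation (dart (subg_of G) k) (subg G x).
have fM : {in G &, {morph f : x y / x * y}}.
  by move=> x y Gx Gy; rewrite /f subgM // translationM ?inE.
have fE (A : {set gT}) : A \subset G ->
    Morphism fM @* A = translation _ @* (subg G @* A).
  by move=> sAG; rewrite !morphimEsub ?subsetT // -imset_comp.
exists (Morphism fM); split.
  apply/isomP; split; last first.
    rewrite fE // im_subg; apply/esym.
    exact: (rigid_aut _ _ _ _ _ rot_rigid refl_rigid).
  apply/injmP=> x y Gx Gy /(injmP (injm_translation (@label_surj _ _ r))).
  by rewrite !inE => /(_ isT isT) /(congr1 sgval); rewrite !subgK.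
have reflE := rigid_reflections _ _ _ _ _ chi_fix rot_rigid refl_rigid.
rewrite reflE fE; last by apply/bigcupsP.
congr (_ @* _); apply/setP=> h; rewrite inE.
have reprE i : K i = repr (K i) ^: G.
  by case/imsetP: (K_class i) (reprK i) => x _ -> /class_eqP.
have invK i x : x \in K i -> x^-1 = x.
  by move=> Kx; rewrite invg_order2 // (K_invol i).
have conj_r i : (h^-1 \in r i ^: [set: subg_of G]) = (sgval h \in K i).
  apply/imsetP/idP => [[g _ Eh] | Kh].
    have: sgval h^-1 \in K i by rewrite Eh /= val_r {2}reprE memJ_class ?subgP.
    by rewrite /= => KVh; rewrite -[sgval h]invgK (invK i).
  have:= Kh; rewrite {1}[K i]reprE => /imsetP[g Gg Eh]; exists (subg G g) => //.
  by apply: val_inj; rewrite /= (invK i) // Eh val_r !subgK.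
apply/morphimP/existsP=> [[x Gx /bigcupP[i _ Kix] Eh] | [d /andP[/eqP]]].
  by exists (inr i); rewrite eqxx /= conj_r Eh /= subgK.
case: d => [[y []]|i] //= _; rewrite conj_r => Kh.
by exists (sgval h); rewrite ?subgP ?sgvalK //; apply/bigcupP; exists i.
Qed.
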